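(* Let $g>0$, $c_L,c_R>0$, $u_L,u_R,a_L,a_R\in\mathbb{R}$, and put $\hat u=\frac{u_L+u_R}{2}$, $\hat c=\frac{c_L+c_R}{2}$, $\hat\lambda_1=\hat u-\hat c$, $\hat\lambda_2=\hat u+\hat c$. Suppose that $\hat\lambda_2<0$. Choose the wave speeds $\lambda_1,\lambda_2$ as follows: $$\text{if } a_R>a_L:\qquad \lambda_1=\hat\lambda_1,\qquad \lambda_2=\min\left(\hat\lambda_2,\ -\frac{g(a_R-a_L)\hat\lambda_1}{4c_R\hat\lambda_1-g(a_R-a_L)}\right);$$ $$\text{if } a_R<a_L:\qquad \lambda_1=\hat\lambda_1,\qquad \lambda_2=\hat\lambda_2.$$ Then in both cases the intermediate state $Y^*$ of the approximate Riemann solver with wave speeds $\lambda_1,\lambda_2$ (torrential configuration with both speeds negative) has nonnegative celerity, i.e. $c^*_l\ge 0$ and $c^*_r\ge 0$.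
   Context: Setting: one-dimensional shallow-water equations with topography in celerity-velocity variables $Y=(2c,u,a)^T$, where $c=\sqrt{gh}$ is the celerity ($h$ water height), $u$ the velocity, $a$ the bottom height and $g>0$ the gravitational acceleration. At an interface, with left state $Y_L=(2c_L,u_L,a_L)^T$ and right state $Y_R=(2c_R,u_R,a_R)^T$ (outside dry zones, so $c_L,c_R>0$), one considers the linearized Riemann problem $\partial_tY+A(\hat Y)\partial_xY=0$, $Y(x,0)=Y_L$ for $x<0$ and $Y_R$ for $x>0$, where $A(Y)=\begin{pmatrix}u&c&0\\c&u&g\\0&0&0\end{pmatrix}$ and $\hat Y=\frac{Y_L+Y_R}{2}$. The eigenvalues of $A(\hat Y)$ are $0$, $\hat\lambda_1=\hat u-\hat c$ and $\hat\lambda_2=\hat u+\hat c$. Approximate solver with wave speeds $\lambda_1,\lambda_2<0$ (torrential configuration with both speeds negative; $\lambda_1,\lambda_2$ replace $\hat\lambda_1,\hat\lambda_2$): let $$r_0=\left(\tfrac{g(\lambda_2-\lambda_1)}{2},\,-\tfrac{g(\lambda_2+\lambda_1)}{2},\,\lambda_2\lambda_1\right)^T,\qquad l_0=\left(0,0,\tfrac{1}{\lambda_2\lambda_1}\right)^T .$$ The intermediate state $Y^*$ consists of the two states on the left and right of the interface $x=0$, $$Y^*_r=Y_R,\qquad Y^*_l=Y^*_r-\big(l_0\cdot(Y_R-Y_L)\big)r_0 ,$$ and its celerities $c^*_l,c^*_r$ are defined by letting $2c^*_l$ and $2c^*_r$ be the first components of $Y^*_l$ and $Y^*_r$; that is,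 $$2c^*_l=2c_R-\frac{g(a_R-a_L)(\lambda_2-\lambda_1)}{2\lambda_2\lambda_1},\qquad 2c^*_r=2c_R .$$ *)

(* Defs.v *)
From mathcomp Require Import all_boot all_order all_algebra.
From mathcomp Require Import reals.
Set Implicit Arguments.
Unset Strict Implicit.
Unset Printing Implicit Defensive.
Import Order.TTheory GRing.Theory Num.Theory.
Local Open Scope ring_scope.

Definition vec3 (R : realType) (x y z : R) : 'cV[R]_3 :=
  \col_i [:: x; y; z]`_i.

Definition dot3 (R : realType) (v w : 'cV[R]_3) : R := \sum_i v i 0 * w i 0.

(* The first coordinate of a state is twice the celerity. *)
Definition state (R : realType) (c u a : R) : 'cV[R]_3 := vec3 (2 * c) u a.

Definition celerity (R : realType) (Y : 'cV[R]_3) : R := Y 0 0 / 2.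

Definition lambda_hat1 (R : realType) (cL cR uL uR : R) : R :=
  (uL + uR) / 2 - (cL + cR) / 2.

Definition lambda_hat2 (R : realType) (cL cR uL uR : R) : R :=
  (uL + uR) / 2 + (cL + cR) / 2.

Definition r0 (R : realType) (g lambda1 lambda2 : R) : 'cV[R]_3 :=
  vec3 (g * (lambda2 - lambda1) / 2)
       (- (g * (lambda2 + lambda1) / 2))
       (lambda2 * lambda1).

Definition l0 (R : realType) (lambda1 lambda2 : R) : 'cV[R]_3 :=
  vec3 0 0 (1 / (lambda2 * lambda1)).

(* Intermediate states of the solver when lambda1, lambda2 < 0: both moving
   waves travel to the left, and only the stationary wave r0 separates
   the left trace from Y_R. *)
Definition Ystar_r (R : realType) (g lambda1 lambda2 : R) (YL YR : 'cV[R]_3) :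
  'cV[R]_3 := YR.

Definition Ystar_l (R : realType) (g lambda1 lambda2 : R) (YL YR : 'cV[R]_3) :
  'cV[R]_3 :=
  Ystar_r g lambda1 lambda2 YL YR
  - dot3 (l0 lambda1 lambda2) (YR - YL) *: r0 g lambda1 lambda2.

(* Main.v *)
Require Import Defs.
From mathcomp Require Import all_boot all_order all_algebra.
From mathcomp Require Import reals.
From mathcomp Require Import ring lra.
Import Order.TTheory GRing.Theory Num.Theory.
Local Open Scope ring_scope.

(** Only the left trace is at stake, since the right one is [Y_R] itself.  Its
    celerity is [cR] minus a multiple of the jump [g (aR - aL)], with a factor
    having the sign of [lambda2 - lambda1].  As [lambda1 * lambda2] is positive,
    clearing denominators turns nonnegativity into the polynomial inequality
    [g (aR - aL) (lambda2 - lambda1) <= 4 cR lambda1 lambda2]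
    ([celerity_Ystar_l_ge0]).  When the bottom goes down, the left side is
    negative.  When it goes up, the inequality is affine in [lambda2], with the
    negative slope [4 cR lambda1 - g (aR - aL)] once all terms are collected on
    one side: it holds exactly below its root, and that root is the second
    argument of the minimum ([positivity_root]). *)

Lemma celerity_Ystar_l (R : realType) (g l1 l2 cL cR uL uR aL aR : R) :
  celerity (Ystar_l g l1 l2 (state cL uL aL) (state cR uR aR))
  = cR - g * (aR - aL) * (l2 - l1) / (4 * (l1 * l2)).
Proof.
rewrite /celerity /Ystar_l /Ystar_r /dot3 /l0 /r0 /state /vec3.
rewrite !big_ord_recl big_ord0 !mxE /=.
rewrite !mul0r !add0r addr0 mul1r [l2 * l1]mulrC [(4 * _)^-1]invfM.
(* The inverse stays opaque: the identity holds for any value of it. *)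
by set w := (l1 * l2)^-1; field.
Qed.

Lemma celerity_Ystar_l_ge0 (R : realType) (g l1 l2 cL cR uL uR aL aR : R) :
  l1 < 0 -> l2 < 0 ->
  (0 <= celerity (Ystar_l g l1 l2 (state cL uL aL) (state cR uR aR)))
  = (g * (aR - aL) * (l2 - l1) <= 4 * cR * (l1 * l2)).
Proof.
move=> l1_lt0 l2_lt0.
have l12_gt0 : 0 < 4 * (l1 * l2) by rewrite mulr_gt0 // nmulr_rgt0.
rewrite celerity_Ystar_l subr_ge0 ler_pdivrMr //.
by rewrite [cR * _]mulrA [cR * 4]mulrC.
Qed.

(** With [k = g (aR - aL)], the difference of the two sides of the positivity
    condition is [l2 (4 c l1 - k) + k l1], which decreases in [l2]. *)
Lemma positivity_root (R : realType) (k c l1 l2 : R) :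
  0 < k -> 0 < c -> l1 < 0 ->
  (l2 <= - (k * l1 / (4 * c * l1 - k))) = (k * (l2 - l1) <= 4 * c * (l1 * l2)).
Proof.
move=> k_gt0 c_gt0 l1_lt0.
have slope_lt0 : 4 * c * l1 - k < 0.
  by rewrite subr_lt0 (lt_trans _ k_gt0) // pmulr_rlt0 // mulr_gt0.
rewrite -mulNr ler_ndivlMr // -subr_ge0 -[RHS]subr_ge0.
by congr (0 <= _); ring.
Qed.

Theorem proposition4p4 (R : realType) (g cL cR uL uR aL aR : R)
    (g_gt0 : 0 < g) (cL_gt0 : 0 < cL) (cR_gt0 : 0 < cR)
    (lambda_hat2_lt0 : lambda_hat2 cL cR uL uR < 0)
    (lambda1 lambda2 : R)
    (wave_speeds :
       [/\ aL < aR,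
           lambda1 = lambda_hat1 cL cR uL uR &
           lambda2 =
             Num.min (lambda_hat2 cL cR uL uR)
                     (- (g * (aR - aL) * lambda_hat1 cL cR uL uR
                         / (4 * cR * lambda_hat1 cL cR uL uR
                            - g * (aR - aL))))]
       \/
       [/\ aR < aL,
           lambda1 = lambda_hat1 cL cR uL uR &
           lambda2 = lambda_hat2 cL cR uL uR]) :
  0 <= celerity (Ystar_l g lambda1 lambda2 (state cL uL aL) (state cR uR aR))
  /\
  0 <= celerity (Ystar_r g lambda1 lambda2 (state cL uL aL) (state cR uR aR)).
Proof.
have hat1_le_hat2 : lambda_hat1 cL cR uL uR <= lambda_hat2 cL cR uL uR.
  by rewrite /lambda_hat1 /lambda_hat2; lra.
have hat1_lt0 := le_lt_trans hat1_le_hat2 lambda_hat2_lt0.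
split; last by rewrite /celerity /Ystar_r /state /vec3 mxE /=; lra.
case: wave_speeds => -[aLR -> def_l2].
  have l2_le_hat2 : lambda2 <= lambda_hat2 cL cR uL uR.
    by rewrite def_l2 ge_min lexx.
  rewrite celerity_Ystar_l_ge0 ?(le_lt_trans l2_le_hat2) //.
  by rewrite -positivity_root ?mulr_gt0 ?subr_gt0 // def_l2 ge_min lexx orbT.
rewrite def_l2 celerity_Ystar_l_ge0 //.
apply: (@le_trans _ _ 0).
  by rewrite mulr_le0_ge0 ?subr_ge0 // pmulr_rle0 // subr_le0 ltW.
by apply: mulr_ge0; [apply: mulr_ge0 => //|apply: mulr_le0]; exact: ltW.
Qed.
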